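(* Let $K\ge 3$ and $v_0\in\{1,\dots,K\}$. Algorithm LF (given in the context) is a linearizable, lock-free, state-quiescent history-independent implementation of a single-writer single-reader (SWSR) $K$-valued register with initial value $v_0$ from binary registers.
   Context: **Model.** An abstract object is a tuple $(Q,q_0,O,R,\Delta)$: states, initial state, operations, responses, and a deterministic sequential specification $\Delta:Q\times O\to Q\times R$; all states are reachable from $q_0$. Asynchronous processes communicate through shared base objects $obj_1,\dots,obj_m$ with state spaces $Q_1,\dots,Q_m$. A (deterministic) implementation gives each process a program for each operation; after an invocation the process takes steps, each consisting of local computation and one atomic primitive operation on a base object, and may eventually return a response. Each process has at most one pending operation (invoked, not yet returned) at a time. A configuration gives the local state of each process and the state of each base object; the initial configuration is unique. An execution is an alternating sequence of configurations and steps from the initial configuration. For a finite execution $\alpha$, $\mathrm{mem}(\alpha)\in Q_1\times\dots\times Q_m$ is the vector of base-object states in its last configuration. $H(\alpha)$ is the sequence of invocations and responses of high-level operations in $\alpha$. **Linearizability.** A completion of $H(\alpha)$ appends responses to zero or more pending operations. A linearization of $\alpha$ is a sequential history that is a permutation of a completion of $H(\alpha)$ (pending operations without responses being dropped), matches the sequential specification, and respects the real-time order of non-overlapping operations. An implementation is linearizable if every execution has a linearization; a linearization function $h$ maps each execution $\alpha$ to a linearization $h(\alpha)$. For a sequential history $H$, $\mathrm{state}(H)$ is the state reached by applying its operations in order from $q_0$. **History independence.** An implementation is HI with respect to a set $E$ of finite executions if for some linearization function $h$, for all $\alpha,\alpha'\in E$ with $\mathrm{state}(h(\alpha))=\mathrm{state}(h(\alpha'))$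 we have $\mathrm{mem}(\alpha)=\mathrm{mem}(\alpha')$. An operation is state-changing if it moves the object from some state $q$ to some $q'\ne q$, and read-only otherwise. A configuration is state-quiescent if no state-changing operation is pending in it. State-quiescent HI means HI with respect to all finite executions ending in a state-quiescent configuration. **Lock-freedom.** Whenever there is a pending operation, some operation returns within a finite number of steps (taken by processes with pending operations). **Register.** A SWSR $K$-valued register has states $\{1,\dots,K\}$, $\mathrm{Write}(v)$ sets the state to $v$, $\mathrm{Read}()$ returns the state; only one process (the writer) invokes Write and only one other process (the reader) invokes Read. A binary register is an atomic read/write register with values in $\{0,1\}$. **Algorithm LF.** Shared binary registers $A[1..K]$, initially all $0$ except $A[v_0]=1$. - $\mathrm{TryRead}()$: for $j=1,\dots,K$: read $A[j]$; if it is $1$, set $val\leftarrow j$, then for $j'=j-1,j-2,\dots,1$ read $A[j']$ and if it is $1$ set $val\leftarrow j'$; then return $val$. If no $1$ is found in the upward scan, return $\bot$. - $\mathrm{Read}()$: repeatedly call $\mathrm{TryRead}()$ until it returns a value other than $\bot$; return that value. - $\mathrm{Write}(v)$: $A[v]\leftarrow 1$; then for $j=v-1,\dots,1$: $A[j]\leftarrow 0$; then for $j=v+1,\dots,K$: $A[j]\leftarrow 0$; return. *)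

(* Defs.v *)
From HB Require Import structures.
From mathcomp Require Import all_boot.

Set Implicit Arguments.
Unset Strict Implicit.
Unset Printing Implicit Defensive.

(** * Sequential objects *)

Record object := Object {
  state : Type;
  init : state;
  op : Type;
  resp : Type;
  delta : state -> op -> state * resp;
  all_reachable : forall q : state,
    exists os : seq op, foldl (fun q o => (delta q o).1) init os = q }.

Definition state_changing (X : object) (o : op X) : Prop :=
  exists q : state X, (delta q o).1 <> q.

Inductive reg_op (T : Type) := Read | Write of T.
Inductive reg_resp (T : Type) := Val of T | Ack.
Arguments Read {T}.
Arguments Ack {T}.

Definition reg_delta (T : Type) (q : T) (o : reg_op T) : T * reg_resp T :=
  match o with
  | Read => (q, Val q)
  | Write v => (v, Ack)
  end.

Lemma reg_reachable (T : Type) (v0 q : T) :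
  exists os, foldl (fun q o => (reg_delta q o).1) v0 os = q.
Proof. by exists [:: Write q]. Qed.

Definition register (T : Type) (v0 : T) : object :=
  Object (@reg_reachable T v0).

Definition binary_register (b0 : bool) : object := register b0.

(** * Implementations *)

(* What a process does next in a given local state [l] while it has a pending
   operation of an object [X]: either it returns, or it applies one primitive
   to one base object and continues, according to the response, in a new local
   state. *)
Inductive action (X : object) (m : nat) (base : 'I_m -> object) (L : Type) :=
| Return of resp X & L
| Access (i : 'I_m) of op (base i) & (resp (base i) -> L).
Arguments Return {X m base L}.
Arguments Access {X m base L}.

(* [may p o] says that process [p] is one of the processes allowed to invoke
   operation [o].  It does not constrain the programs, only the executions. *)
Record implementation (P : finType) (X : object) (may : P -> op X -> bool)
    (m : nat) (base : 'I_m -> object) := Implementation {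
  local : Type;
  local_init : P -> local;
  start : P -> local -> op X -> local;
  next_action : P -> local -> action X base local }.

Section Model.
Variables (P : finType) (X : object) (may : P -> op X -> bool).
Variables (m : nat) (base : 'I_m -> object).
Variable I : implementation may base.

Record config := Config {
  loc : P -> local I;
  pending : P -> option (op X);
  memory : forall i : 'I_m, state (base i) }.

Definition init_config : config :=
  Config (local_init I) (fun=> None) (fun i => init (base i)).

(* Returning is an event separate from the last access of the operation: an
   operation stays pending until its [Respond] event. *)
Inductive event :=
| Invoke of P & op X
| Step of P
| Respond of P & resp X.

Definition upd (T : Type) (f : P -> T) (p : P) (x : T) : P -> T :=
  fun p' => if p' == p then x else f p'.

Inductive step (c : config) : event -> config -> Prop :=
| step_invoke p o :
    may p o -> pending c p = None ->
    step c (Invoke p o)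
      (Config (upd (loc c) p (start p (loc c p) o))
              (upd (pending c) p (Some o))
              (memory c))
| step_access p o i a k :
    pending c p = Some o ->
    next_action p (loc c p) = Access i a k ->
    step c (Step p)
      (Config (upd (loc c) p (k (delta (memory c i) a).2))
              (pending c)
              (dfwith (memory c) (delta (memory c i) a).1))
| step_respond p o r l :
    pending c p = Some o ->
    next_action p (loc c p) = Return r l ->
    step c (Respond p r)
      (Config (upd (loc c) p l) (upd (pending c) p None) (memory c)).

(** ** Finite and infinite executions *)

(* A finite execution [c0 e1 c1 ... en cn], where [c0] is the initial
   configuration, is represented by [:: (e1, c1); ...; (en, cn)]. *)
Definition fin_seq := seq (event * config).

Fixpoint steps_from (c : config) (al : fin_seq) : Prop :=
  if al is (e, c') :: al' then step c e c' /\ steps_from c' al' else True.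

Definition fin_execution (al : fin_seq) : Prop := steps_from init_config al.

Definition last_config (al : fin_seq) : config :=
  last init_config [seq x.2 | x <- al].

Definition inf_execution (cs : nat -> config) (es : nat -> event) : Prop :=
  cs 0 = init_config /\ forall n, step (cs n) (es n) (cs n.+1).

(** ** Linearizability *)

(* Finite and infinite sequences are both viewed as functions into [option],
   a finite sequence [s] being [onth s].  An operation of an execution is
   identified by the position of its invocation in the sequence of events;
   internal steps occupy positions but play no other role below, so only the
   history of invocations and responses matters. *)

(* The operation invoked at [i] returns [r] at [j]. *)
Definition returns_at (ev : nat -> option event) (i j : nat) (r : resp X) :=
  exists p o,
    [/\ ev i = Some (Invoke p o), i < j, ev j = Some (Respond p r)
      & forall k r', i < k < j -> ev k <> Some (Respond p r')].

Definition precedes (ev : nat -> option event) (i i' : nat) : Prop :=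
  exists j r, returns_at ev i j r /\ j < i'.

(* A completion gives the response of each operation: the actual one if the
   operation returns; for a pending operation, either an added response or
   [None], in which case the operation is dropped. *)
Definition completion (ev : nat -> option event) (f : nat -> option (resp X)) :=
  (forall i r, f i = Some r -> exists p o, ev i = Some (Invoke p o)) /\
  (forall i j r, returns_at ev i j r -> f i = Some r).

(* An entry of a sequential history: an invocation immediately followed by its
   response, with the identifier of the operation. *)
Record entry := Entry {
  ident : nat; proc : P; oper : op X; result : resp X }.

(* [L] lists each operation of the completion [f] exactly once. *)
Definition permutes (ev : nat -> option event) (f : nat -> option (resp X))
    (L : nat -> option entry) : Prop :=
  [/\ forall n, L n = None -> L n.+1 = None,
      forall i p o r,
        (exists n, L n = Some (Entry i p o r)) <->
        (ev i = Some (Invoke p o) /\ f i = Some r)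
    & forall n n' x x', L n = Some x -> L n' = Some x' ->
        ident x = ident x' -> n = n'].

Definition legal (L : nat -> option entry) : Prop :=
  exists qs : nat -> state X, qs 0 = init X /\
    forall n x, L n = Some x -> delta (qs n) (oper x) = (qs n.+1, result x).

Definition respects_real_time (ev : nat -> option event)
    (L : nat -> option entry) : Prop :=
  forall n n' x x', L n = Some x -> L n' = Some x' ->
    precedes ev (ident x) (ident x') -> n < n'.

Definition linearization (ev : nat -> option event)
    (L : nat -> option entry) : Prop :=
  (exists f, completion ev f /\ permutes ev f L) /\
  legal L /\ respects_real_time ev L.

Definition fin_linearization (al : fin_seq) (L : seq entry) : Prop :=
  linearization (onth [seq x.1 | x <- al]) (onth L).

Definition linearizable : Prop :=
  (forall al, fin_execution al -> exists L, fin_linearization al L) /\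
  (forall cs es, inf_execution cs es ->
     exists L, linearization (fun n => Some (es n)) L).

(** ** History independence *)

Definition final_state (L : seq entry) : state X :=
  foldl (fun q x => (delta q (oper x)).1) (init X) L.

(* [E] is meant to be a set of finite executions, so only the values of a
   linearization function on finite executions are relevant. *)
Definition HI (E : fin_seq -> Prop) : Prop :=
  exists h : fin_seq -> seq entry,
    (forall al, fin_execution al -> fin_linearization al (h al)) /\
    (forall al al', E al -> E al' ->
       final_state (h al) = final_state (h al') ->
       forall i, memory (last_config al) i = memory (last_config al') i).

Definition state_quiescent (c : config) : Prop :=
  forall p o, pending c p = Some o -> ~ state_changing o.

Definition state_quiescent_HI : Prop :=
  HI (fun al => fin_execution al /\ state_quiescent (last_config al)).

(** ** Lock-freedom *)

Definition is_invoke (e : event) : bool := if e is Invoke _ _ then true else false.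
Definition is_respond (e : event) : bool := if e is Respond _ _ then true else false.

(* Steps and responses are only taken by processes with a pending operation,
   so the second hypothesis says that such processes take infinitely many
   steps. *)
Definition lock_free : Prop :=
  forall cs es, inf_execution cs es ->
  forall n, (exists p o, pending (cs n) p = Some o) ->
  (forall k, exists2 k', k <= k' & ~~ is_invoke (es k')) ->
  exists2 n', n <= n' & is_respond (es n').

End Model.

Arguments Invoke {P X}.
Arguments Step {P X}.
Arguments Respond {P X}.

(** * Single-writer single-reader registers *)

Inductive swsr_proc := Writer | Reader.

Definition bool_of_proc (p : swsr_proc) : bool :=
  if p is Writer then true else false.
Definition proc_of_bool (b : bool) : swsr_proc := if b then Writer else Reader.
Lemma bool_of_procK : cancel bool_of_proc proc_of_bool.
Proof. by case. Qed.

HB.instance Definition _ := Finite.copy swsr_proc (can_type bool_of_procK).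

Definition swsr (T : Type) (p : swsr_proc) (o : reg_op T) : bool :=
  match p, o with
  | Writer, Write _ => true
  | Reader, Read => true
  | _, _ => false
  end.

(** * Algorithm LF *)

Section LF.
(* The values [1..K] and the indices of the array [A[1..K]] are both
   represented by ['I_K]: the ordinal [j] stands for [j + 1]. *)
Variables (K : nat) (v0 : 'I_K).

Definition lf_array (i : 'I_K) : object := binary_register (i == v0).

Definition all_cells : seq 'I_K := enum 'I_K.
Definition cells_below (j : 'I_K) : seq 'I_K := rev [seq i : 'I_K <- all_cells | i < j].
Definition cells_above (j : 'I_K) : seq 'I_K := [seq i : 'I_K <- all_cells | j < i].

(* In [ScanUp js] (resp. [ScanDown js val]) the reader still has to read the
   cells [js], in this order, in the upward (resp. downward) scan of the
   current TryRead.  [ScanUp [::]] is reached when TryRead fails; since Read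
   then calls TryRead again, it behaves as [ScanUp all_cells].  In [Writing ws]
   it remains to perform the writes [ws]. *)
Inductive lf_local :=
| Idle
| ScanUp of seq 'I_K
| ScanDown of seq 'I_K & 'I_K
| Writing of seq ('I_K * bool).

Definition lf_start (l : lf_local) (o : reg_op 'I_K) : lf_local :=
  match o with
  | Read => ScanUp all_cells
  | Write v => Writing ((v, true) ::
      [seq (j, false) | j <- cells_below v ++ cells_above v])
  end.

Definition is_one (r : reg_resp bool) : bool := if r is Val b then b else false.

Local Notation action := (action (register v0) lf_array lf_local).
Local Notation Return := (@Return (register v0) K lf_array lf_local).
Local Notation Access := (@Access (register v0) K lf_array lf_local).

Definition lf_scan_up (js : seq 'I_K) : action :=
  match js with
  | j :: js' => Access j Read (fun r : reg_resp bool =>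
      if is_one r then ScanDown (cells_below j) j else ScanUp js')
  | [::] => Return Ack Idle (* not used: [lf_next] never passes [::] *)
  end.

Definition lf_next (l : lf_local) : action :=
  match l with
  | Idle => Return Ack Idle (* irrelevant: no operation is pending *)
  | ScanUp [::] => lf_scan_up all_cells
  | ScanUp js => lf_scan_up js
  | ScanDown (j :: js) val => Access j Read (fun r =>
      ScanDown js (if is_one r then j else val))
  | ScanDown [::] val => Return (Val val) Idle
  | Writing ((j, b) :: ws) => Access j (Write b) (fun=> Writing ws)
  | Writing [::] => Return Ack Idle
  end.

Definition LF :
    @implementation swsr_proc (register v0) (@swsr 'I_K) K lf_array :=
  @Implementation swsr_proc (register v0) (@swsr 'I_K) K lf_array lf_local
    (fun=> Idle) (fun=> lf_start) (fun=> lf_next).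

End LF.

(* Main.v *)
Require Import Defs.
From mathcomp Require Import all_boot.
From mathcomp Require Import boolp.

(* The abstract value of the register is the least index of a cell containing 1.
   Between writes the array contains a single 1. A write of v to a register of
   value u first sets A[v]; while it runs the array is contained in {u, v}, and
   its least 1 moves from u to v in one step: the clearing of A[u] if u < v, the
   setting of A[v] otherwise. This step is the linearization point of the write.

   A read returning val can be linearized at some moment of its interval at which
   val is the least 1. Consider the last 1 it reads, in A[val]. If val is not the
   least 1 at that time, then the array is {c, val} with c < val, and A[c] is later
   read as 0. Either c is the old value, and val becomes the least 1 when A[c] is
   cleared, before A[c] is read; or c is the new value, and since A[c] was also
   read as 0 during the upward scan, A[c] was set after the read started, when val
   was still the least 1. *)

Set Implicit Arguments.
Unset Strict Implicit.
Unset Printing Implicit Defensive.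

(** Classical: excluded middle decides whether [R a] is inhabited, and choice collects the
    answers. *)
Lemma functional_choice (A B : Type) (R : A -> B -> Prop) :
    (forall a b b', R a b -> R a b' -> b = b') ->
  exists f : A -> option B, forall a b, f a = Some b <-> R a b.
Proof.
move=> Rfun; suff /choice[f fP] : forall a, exists o, forall b, o = Some b <-> R a b by exists f.
move=> a; case: (pselect (exists b, R a b)) => [[b Rab]|noR].
  by exists (Some b) => b'; split=> [[<-]//|Rab']; rewrite (Rfun _ _ _ Rab Rab').
by exists None => b; split=> // Rab; case: noR; exists b.
Qed.

(** * Compressing a sequence of options *)

Section Compression.
Variables (T : Type) (E : nat -> option T).

Definition compressed (k : nat) : seq T := pmap E (iota 0 k).
Definition rank (k : nat) : nat := size (compressed k).

Lemma compressedS k : compressed k.+1 = compressed k ++ oapp (cons^~ [::]) [::] (E k).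
Proof. by rewrite /compressed -addn1 iotaD pmap_cat /=; case: (E k). Qed.

Lemma rankS k : rank k.+1 = rank k + (E k : bool).
Proof. by rewrite /rank compressedS size_cat; case: (E k). Qed.

Lemma leq_rank k k' : k <= k' -> rank k <= rank k'.
Proof.
move=> /subnK <-; elim: (k' - k) => // d IHd.
by rewrite addSn rankS (leq_trans IHd) ?leq_addr.
Qed.

Lemma rank_lt k k' x : k < k' -> E k = Some x -> rank k < rank k'.
Proof. by move=> /leq_rank + Ek; rewrite rankS Ek addn1. Qed.

Lemma rank_inj k k' x x' : E k = Some x -> E k' = Some x' -> rank k = rank k' -> k = k'.
Proof.
move=> Ek Ek' eq_rank; case: (ltngtP k k') => //.
- by move/rank_lt/(_ Ek); rewrite eq_rank ltnn.
- by move/rank_lt/(_ Ek'); rewrite eq_rank ltnn.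
Qed.

Lemma rank_surj n k : n < rank k -> exists2 k', k' < k & E k' /\ rank k' = n.
Proof.
elim: k => // k IHk; rewrite rankS => n_lt.
have [/IHk [k' lt_k' Hk']|le_n] := ltnP n (rank k).
  by exists k' => //; apply: leqW.
case Ek: (E k) n_lt => [x|] /=; last by rewrite addn0 ltnNge le_n.
rewrite addn1 ltnS => ge_n; exists k => //; rewrite Ek; split=> //.
by apply/eqP; rewrite eqn_leq ge_n le_n.
Qed.

(** [L] lists the values of [E] without gaps: the value at [k] moves to position [rank k]. Being a
    relation, this covers finite and infinite sequences alike. *)
Definition compression (L : nat -> option T) : Prop :=
  forall n x, L n = Some x <-> exists2 k, E k = Some x & rank k = n.

Lemma compression_exists : exists L, compression L.
Proof.
apply: (@functional_choice _ _ (fun n x => exists2 k, E k = Some x & rank k = n)).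
move=> n x x' [k Ek <-] [k' Ek' /esym eq_rank].
by have := Ek'; rewrite -(rank_inj Ek Ek' eq_rank) Ek => -[].
Qed.

Lemma compression_finite N : (forall k, E k -> k < N) -> compression (onth (compressed N)).
Proof.
move=> bounded n x.
have -> : (exists2 k, E k = Some x & rank k = n) <->
          (exists2 k, k < N & E k = Some x /\ rank k = n).
  split=> [[k Ek rk]|[k _ [Ek rk]]]; exists k => //.
  by apply: bounded; rewrite Ek.
elim: N {bounded} => [|N IHN]; first by rewrite onth0n; split=> // -[].
rewrite compressedS onth_cat -/(rank N); split=> [|[k]].
  case: ltnP => [_ /IHN [k lt_k Hk]|le_n]; first by exists k => //; apply: leqW.
  case EN: (E N) => [y|] /=; last by rewrite onth0n.
  move=> /onth1P [/eqP]; rewrite subn_eq0 => ge_n <-.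
  by exists N => //; split=> //; apply/eqP; rewrite eqn_leq le_n ge_n.
rewrite ltnS leq_eqVlt => /predU1P [-> [EN <-]|lt_k [Ek rk]].
  by rewrite ltnn EN subnn.
rewrite -{1}rk (rank_lt lt_k Ek); apply/IHN; by exists k.
Qed.

Lemma compression_prefix L n : compression L -> L n = None -> L n.+1 = None.
Proof.
move=> LP Ln; case Lsn: L => [x|] //.
have [k Ek rk] := (LP _ _).1 Lsn.
have [|k' _ [+ rk']] := @rank_surj n k; first by rewrite rk.
case Ek': (E k') => [y|] // _.
by have := (LP n y).2 (ex_intro2 _ _ k' Ek' rk'); rewrite Ln.
Qed.

End Compression.

(** * Linearization points *)

Section Histories.
Variables (P : finType) (X : object).
Implicit Types (ev : nat -> option (event P X)) (E : nat -> option (entry P X)).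

Lemma returns_at_inj ev i j j' r r' :
  returns_at ev i j r -> returns_at ev i j' r' -> j = j' /\ r = r'.
Proof.
move=> [p [o [evi ij evj noresp]]] [p' [o' [evi' ij' evj' noresp']]].
move: evi' noresp' evj'; rewrite evi => -[<- _] noresp' evj'.
case: (ltngtP j j') => [lt_j|lt_j|eq_j].
- by case: (noresp' j r); rewrite ?ij ?lt_j.
- by case: (noresp j' r'); rewrite ?ij' ?lt_j.
by split=> //; move: evj; rewrite eq_j evj' => -[].
Qed.

(* Event [k] sits at time [2k] of the points at which operations take effect, so
   that time [2k + 1] lies strictly between events [k] and [k + 1]. *)
Record linearization_points ev E (q : nat -> state X) : Prop :=
  LinearizationPoints {
  point_invoked k x : E k = Some x -> ev (ident x) = Some (Invoke (proc x) (oper x));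
  point_after k x : E k = Some x -> (ident x).*2 < k;
  point_unique k k' x x' : E k = Some x -> E k' = Some x' -> ident x = ident x' -> k = k';
  point_before i j r : returns_at ev i j r ->
    exists k x, [/\ E k = Some x, ident x = i, result x = r & k < j.*2];
  point_init : q 0 = init X;
  point_legal k x : E k = Some x -> delta (q k) (oper x) = (q k.+1, result x);
  point_none k : E k = None -> q k.+1 = q k }.

(** The completion gives each operation the result recorded at its point. Between points [q] is
    constant, so the states along [L] are those of [q] at the points. If one operation returns at
    [j] and another is invoked at [i' > j], their points lie before time [2j] and after time
    [2i']. *)
Lemma linearization_of_points ev E q L :
  linearization_points ev E q -> compression E L -> linearization ev L.
Proof.
move=> pts LP; have [inv after uni bef q0 leg non] := pts; split; last split.
- have [f fP] : exists f : nat -> option (resp X), forall i r,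
      f i = Some r <-> exists k x, [/\ E k = Some x, ident x = i & result x = r].
    apply: functional_choice => i r r' [k [x [Ek xi <-]]] [k' [x' [Ek' xi' <-]]].
    have eqk := uni _ _ _ _ Ek Ek' (etrans xi (esym xi')).
    by move: Ek'; rewrite -eqk Ek => -[<-].
  exists f; split; first split.
  - by move=> i r /fP [k [x [/inv Ek <- _]]]; exists (proc x), (oper x).
  - by move=> i j r /bef [k [x [Ek xi xr _]]]; apply/fP; exists k, x.
  split.
  - by move=> n; apply: compression_prefix.
  - move=> i p o r; split=> [[n /LP [k Ek _]]|[evi /fP [k [x [Ek xi xr]]]]].
      by split; [apply: (inv _ _ Ek) | apply/fP; exists k, (Entry i p o r)].
    exists (rank E k); apply/LP; exists k => //.
    move: evi (inv _ _ Ek); rewrite xi => -> [-> ->]; rewrite Ek -xi -xr.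
    by case: (x).
  - by move=> n n' x x' /LP [k Ek <-] /LP [k' Ek' <-] /(uni _ _ _ _ Ek Ek') ->.
- pose qs := fix qs n := if n is n'.+1 then
    (if L n' is Some x then (delta (qs n') (oper x)).1 else qs n') else init X.
  have qsE k : qs (rank E k) = q k.
    elim: k => [|k IHk]; first by rewrite q0.
    rewrite rankS; case Ek: (E k) => [x|]; last by rewrite addn0 IHk non.
    have Lk : L (rank E k) = Some x by apply/LP; exists k.
    by rewrite addn1 /= Lk IHk (leg _ _ Ek).
  exists qs; split=> // n x Ln; have [k Ek rk] := (LP _ _).1 Ln.
  by rewrite /= Ln -rk qsE (leg _ _ Ek).
- move=> n n' x x' /LP [k Ek <-] /LP [k' Ek' <-] [j [r [/bef[l [y [El yx _ lj]]] jx']]].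
  apply: rank_lt (Ek); rewrite -(uni _ _ _ _ El Ek yx).
  by apply: ltn_trans lj _; apply: leq_ltn_trans (after _ _ Ek'); rewrite leq_double ltnW.
Qed.

Lemma final_state_of_points ev E q k :
  linearization_points ev E q -> final_state (compressed E k) = q k.
Proof.
case=> _ _ _ _ q0 leg non; elim: k => [|k IHk]; first by rewrite q0.
rewrite /final_state compressedS foldl_cat -/(final_state _) IHk.
by case Ek: (E k) => [x|] /=; [rewrite (leg _ _ Ek)|rewrite non].
Qed.

End Histories.

(** * Traces *)

Section Traces.
Variables (P : finType) (X : object) (may : P -> op X -> bool).
Variables (m : nat) (base : 'I_m -> object) (I : implementation may base).
Implicit Types (ev : nat -> option (event P X)) (cs : nat -> config I).

(* A finite execution is extended by repeating its last configuration. *)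
Definition trace ev cs : Prop :=
  cs 0 = init_config I /\
  forall n, if ev n is Some e then step (cs n) e (cs n.+1) else cs n.+1 = cs n.

Lemma trace_inf cs es : inf_execution cs es -> trace (fun n => Some (es n)) cs.
Proof. by []. Qed.

Lemma trace_fin (al : fin_seq I) : fin_execution al ->
  trace (onth [seq x.1 | x <- al]) (fun n => last_config (take n al)).
Proof.
rewrite /fin_execution /last_config; split; first by rewrite take0.
elim: al (init_config I) H => [|[e c'] al IHal] c /=; first by move=> _ [].
by move=> [Hstep Hal] [|n] /=; [rewrite take0 | apply: IHal].
Qed.

(** The operation invoked at [i] is pending in configuration [cs n], which precedes event [n]. *)
Definition open_at ev p o i n : Prop :=
  [/\ ev i = Some (Invoke p o), i < n
    & forall k r, i < k < n -> ev k <> Some (Respond p r)].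

Lemma step_pending (c c' : config I) e : step c e c' ->
  pending c' = match e with
    | Invoke p o => upd (pending c) p (Some o)
    | Step _ => pending c
    | Respond p _ => upd (pending c) p None
    end.
Proof. by case. Qed.

Lemma step_invoke_inv (c c' : config I) p o : step c (Invoke p o) c' ->
  may p o /\ pending c p = None.
Proof. by move=> H; inversion H. Qed.

Variables (ev : nat -> option (event P X)) (cs : nat -> config I).
Hypothesis tr : trace ev cs.

Lemma open_atS p o i n : open_at ev p o i n.+1 ->
  [/\ i = n & ev n = Some (Invoke p o)] \/
  [/\ open_at ev p o i n & forall r, ev n <> Some (Respond p r)].
Proof.
move=> [evi]; rewrite ltnS leq_eqVlt => /predU1P [<- _|lt_i noresp]; first by left.
right; split=> [|r]; last by apply: noresp; rewrite lt_i leqnn.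
by split=> // k r /andP[ik kn]; apply: noresp; rewrite ik ltnW.
Qed.

Lemma open_at_pending p o i n : open_at ev p o i n -> pending (cs n) p = Some o.
Proof.
elim: n => [|n IHn]; first by case.
move=> /open_atS [[_ evn]|[/IHn pend noresp]]; move: (tr.2 n).
  by rewrite evn => /step_pending ->; rewrite /upd eqxx.
case evn: (ev n) noresp => [e|] noresp st; last by rewrite st.
rewrite (step_pending st); case: e => [p' o'|p'|p' r'] // in evn st noresp *; rewrite /upd.
  by case: eqP st => // <- /step_invoke_inv []; rewrite pend.
by case: eqP noresp => // <- /(_ r').
Qed.

Lemma pending_open_at p o n : pending (cs n) p = Some o -> exists i, open_at ev p o i n.
Proof.
elim: n => [|n IHn]; first by rewrite tr.1.
have keep : pending (cs n) p = Some o -> (forall r, ev n <> Some (Respond p r)) ->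
    exists i, open_at ev p o i n.+1.
  move=> /IHn [i [evi lt_i noresp]] evn; exists i; split=> //; first exact: leqW.
  move=> k r /andP[ik]; rewrite ltnS leq_eqVlt => /predU1P [->//|kn].
  by apply: noresp; rewrite ik.
move: (tr.2 n); case evn: (ev n) keep => [e|] keep st; last first.
  by rewrite st => /keep; apply.
rewrite (step_pending st); case: e => [p' o'|p'|p' r'] in evn st keep *; rewrite /upd.
- case: eqP => [-> [<-]|_ /keep]; last exact.
  exists n; split=> // k r /andP[nk]; rewrite ltnS => kn.
  by move: nk; rewrite ltnNge kn.
- by move=> /keep; apply.
- by case: eqP => // np /keep; apply=> r0 [ep _]; case: np.
Qed.

Lemma open_at_inj p o o' i i' n : open_at ev p o i n -> open_at ev p o' i' n -> i = i'.
Proof.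
have le : forall i i' o o', open_at ev p o i n -> open_at ev p o' i' n -> i' <= i.
  move=> {o o' i i'} i i' o o' [evi _ noresp] [evi' lt_i' _]; rewrite leqNgt.
  apply/negP => lt_i; have /open_at_pending : open_at ev p o i i'.
    by split=> // k r /andP[ik ki']; apply: noresp; rewrite ik (ltn_trans ki').
  by move: (tr.2 i'); rewrite evi' => /step_invoke_inv[_ ->].
by move=> Ho Ho'; apply/eqP; rewrite eqn_leq (le _ _ _ _ Ho Ho') (le _ _ _ _ Ho' Ho).
Qed.

Lemma returns_open_at i j r n : returns_at ev i j r -> i < n <= j ->
  exists p o, open_at ev p o i n.
Proof.
move=> [p [o [evi ij evj noresp]]] /andP[lt_i le_j]; exists p, o; split=> // k r' /andP[ik kn].
by apply: noresp; rewrite ik (leq_trans kn).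
Qed.

Lemma open_at_may p o i n : open_at ev p o i n -> may p o.
Proof. by case=> evi _ _; move: (tr.2 i); rewrite evi => /step_invoke_inv[]. Qed.

End Traces.

(** The type of [k] depends on [i], so injectivity of [Access] would only give equalities of
    dependent pairs; matching on the action transports [Q] without them. *)
Lemma access_elim (X : object) (m : nat) (base : 'I_m -> object) (L : Type)
    (Q : forall i, op (base i) -> (resp (base i) -> L) -> Prop) i a k :
  Q i a k -> forall i' a' k',
  Access i a k = Access i' a' k' :> action X base L -> Q i' a' k'.
Proof.
move=> Qiak i' a' k' e.
pose Q' (act : action X base L) := if act is Access i a k then Q i a k else False.
by rewrite -/(Q' (Access i' a' k')) -e.
Qed.

(** * The views of the writer and of the reader *)

Section LFCorrectness.
Variables (K : nat) (v0 : 'I_K).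
Local Notation idle := (Idle K).
Local Notation cells := (all_cells K).

Local Notation event := (event swsr_proc (register v0)).
Local Notation Invoke := (@Invoke swsr_proc (register v0)).
Local Notation Respond := (@Respond swsr_proc (register v0)).

Section Views.
Implicit Types (i j u v : 'I_K) (M : 'I_K -> bool).

(** * Cells in scanning order, and the least 1 of an array *)

Lemma mem_all_cells j : j \in cells.
Proof. by rewrite mem_enum. Qed.

Lemma sorted_all_cells : sorted (fun i j : 'I_K => i < j) cells.
Proof. by have := iota_ltn_sorted 0 K; rewrite -val_enum_ord sorted_map. Qed.

Lemma size_all_cells : size cells = K.
Proof. exact: size_enum_ord. Qed.

Lemma mem_cells_below i j : (i \in cells_below j) = (i < j).
Proof. by rewrite mem_rev mem_filter mem_all_cells andbT. Qed.

Lemma sorted_cells_below j : sorted (fun i i' : 'I_K => i' < i) (cells_below j).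
Proof.
rewrite rev_sorted; apply: sorted_filter sorted_all_cells.
by move=> ? ? ?; apply: ltn_trans.
Qed.

Lemma mem_cells_above i j : (i \in cells_above j) = (j < i).
Proof. by rewrite mem_filter mem_all_cells andbT. Qed.

Lemma sorted_ord_lt (j : 'I_K) js : sorted (fun i i' : 'I_K => i < i') (j :: js) ->
  sorted (fun i i' : 'I_K => i < i') js /\ forall i, i \in js -> j < i.
Proof.
move=> s; split; first exact: path_sorted s.
by apply/allP; apply: order_path_min s => ? ? ?; apply: ltn_trans.
Qed.

Lemma sorted_ord_gt (j : 'I_K) js : sorted (fun i i' : 'I_K => i' < i) (j :: js) ->
  sorted (fun i i' : 'I_K => i' < i) js /\ forall i, i \in js -> i < j.
Proof.
move=> s; split; first exact: path_sorted s.
by apply/allP; apply: order_path_min s => ? ? ? /[swap]; apply: ltn_trans.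
Qed.

Lemma size_uniq_ord (js : seq 'I_K) : uniq js -> size js <= K.
Proof. by move=> /card_uniqP <-; rewrite -[leqRHS]card_ord max_card. Qed.

Lemma sorted_lt_size (js : seq 'I_K) : sorted (fun i j : 'I_K => i < j) js -> size js <= K.
Proof.
move=> s; apply: size_uniq_ord; apply: sorted_uniq s => [? ? ?|i]; last exact: ltnn.
exact: ltn_trans.
Qed.

Lemma sorted_gt_size (js : seq 'I_K) : sorted (fun i j : 'I_K => j < i) js -> size js <= K.
Proof. by rewrite -rev_sorted -(size_rev js) => /sorted_lt_size. Qed.

Lemma cells_nonempty : cells <> [::].
Proof. by move=> e; have := mem_all_cells v0; rewrite e. Qed.

(** The abstract value of the register. The default [v0] is for the array of zeros, which
    [writer_inv] excludes. *)
Definition least M : 'I_K :=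
  if [pick j | M j] is Some j then [arg min_(i < j | M i) i] else v0.

Lemma leastP M i : M i -> M (least M) /\ least M <= i.
Proof.
rewrite /least => Mi; case: pickP => [j Mj|/(_ i)]; last by rewrite Mi.
by case: arg_minnP => // k Mk k_min; split=> //; apply: k_min.
Qed.

Lemma leastE M u : M u -> (forall i, M i -> u <= i) -> least M = u.
Proof.
move=> Mu min_u; have [Ml le_lu] := leastP Mu.
by apply/val_inj/eqP; rewrite eqn_leq le_lu min_u.
Qed.

Lemma least1 M u : M =1 pred1 u -> least M = u.
Proof. by move=> ME; apply: leastE => [|i]; rewrite ME /= => // /eqP ->. Qed.

Lemma least2 M u v : M =1 pred2 u v -> u < v -> least M = u.
Proof.
move=> ME lt_uv; apply: leastE => [|i]; rewrite ME /= ?eqxx // => /pred2P[]-> //.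
exact: ltnW.
Qed.

(** * Views and their transitions *)

Definition set_cell M j b : 'I_K -> bool := fun i => if i == j then b else M i.

(** What the invariants need of a configuration, free of the dependent types of [base]; [writing]
    holds the argument of the pending write. *)
Record view := View {
  array : 'I_K -> bool;
  writing : option 'I_K;
  writer_loc : lf_local K;
  reading : bool;
  reader_loc : lf_local K }.

(** The program of LF unfolded for case analysis. In [view_read_up] an empty [js0] is a failed
    TryRead that starts again from [cells]. *)
Inductive view_step : view -> event -> view -> Prop :=
| view_invoke_write M wl rp rl v :
    view_step (View M None wl rp rl) (Invoke Writer (Write v))
              (View M (Some v) (lf_start wl (Write v)) rp rl)
| view_write M v j b ws rp rl :
    view_step (View M (Some v) (Writing ((j, b) :: ws)) rp rl) (Step Writer)
              (View (set_cell M j b) (Some v) (Writing ws) rp rl)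
| view_return_write M v rp rl :
    view_step (View M (Some v) (Writing [::]) rp rl) (Respond Writer Ack)
              (View M None idle rp rl)
| view_invoke_read M wp wl rl :
    view_step (View M wp wl false rl) (Invoke Reader Read)
              (View M wp wl true (ScanUp cells))
| view_read_up M wp wl js0 j js :
    (if js0 is [::] then cells else js0) = j :: js ->
    view_step (View M wp wl true (ScanUp js0)) (Step Reader)
      (View M wp wl true (if M j then ScanDown (cells_below j) j else ScanUp js))
| view_read_down M wp wl j js val :
    view_step (View M wp wl true (ScanDown (j :: js) val)) (Step Reader)
              (View M wp wl true (ScanDown js (if M j then j else val)))
| view_return_read M wp wl val :
    view_step (View M wp wl true (ScanDown [::] val)) (Respond Reader (Val val))
              (View M wp wl false idle).

Definition config_view (c : config (LF v0)) : view :=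
  View (memory c) (if pending c Writer is Some (Write v) then Some v else None)
    (loc c Writer) (isSome (pending c Reader)) (loc c Reader).

Definition writer_wf (c : config (LF v0)) : Prop :=
  if pending c Writer is Some o then
    exists v ws, o = Write v /\ loc c Writer = Writing ws
  else True.

Definition reader_wf (c : config (LF v0)) : Prop :=
  if pending c Reader is Some o then
    o = Read /\ match loc c Reader with
      | ScanUp _ | ScanDown _ _ => True
      | _ => False end
  else True.

Lemma dfwith_set_cell M j b :
  @dfwith _ (fun=> bool) M j b = (set_cell M j b).
Proof.
apply: funext => i; rewrite /set_cell.
have [->|ne] := eqVneq i j; first by rewrite dfwith_in.
by rewrite dfwith_out // eq_sym.
Qed.

(** A read access also updates the memory, with the value already stored; this identity erases the
    update. *)
Lemma set_cell_id M j : set_cell M j (M j) = M.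
Proof. by apply: funext => i; rewrite /set_cell; case: eqP => // ->. Qed.

Lemma config_step (c c' : config (LF v0)) e : step c e c' ->
    writer_wf c -> reader_wf c ->
  [/\ writer_wf c', reader_wf c' & view_step (config_view c) e (config_view c')].
Proof.
rewrite /writer_wf /reader_wf /config_view.
case=> [p o may_o pend|p o i a k pend act|p o r l pend act] /=.
- case: p o pend may_o => [] [|v] // pend _; rewrite /upd /= pend.
    by move=> _ rwf; split=> //; [exists v; eexists | exact: view_invoke_write].
  by move=> wwf _; split=> //; exact: view_invoke_read.
- case: p pend act => pend; rewrite /upd /= pend.
    move=> + [v [ws [-> eq_loc]]] rwf; rewrite eq_loc.
    case: ws eq_loc => [|[j b] ws] //= eq_loc.
    move: i a k; apply: access_elim => /=; split=> //; first by exists v, ws.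
    by rewrite dfwith_set_cell; apply: view_write.
  case eq_loc: (loc c Reader) => [|js|[|j js] val|ws] //=; try by move=> _ _ [].
    case js_eq: (if js is [::] then cells else js) => [|j js'].
      by case: js js_eq {eq_loc} => // /cells_nonempty.
    have -> : (if js is [::] then lf_scan_up v0 cells else lf_scan_up v0 js) = lf_scan_up v0 (j :: js').
      by rewrite -js_eq; case: js {js_eq eq_loc}.
    move: i a k; apply: access_elim => /= wwf [-> _]; split=> //.
      by split=> //; case: ifP.
    by rewrite dfwith_set_cell set_cell_id; apply: view_read_up.
  move: i a k; apply: access_elim => /= wwf [-> _]; split=> //.
  by rewrite dfwith_set_cell set_cell_id; apply: view_read_down.
- case: p pend act => pend; rewrite /upd /= pend.
    move=> + [v [ws [-> eq_loc]]] rwf; rewrite eq_loc.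
    case: ws eq_loc => [|[j b] ws] //= eq_loc [<- <-]; split=> //.
    exact: view_return_write.
  case eq_loc: (loc c Reader) => [|[|j js]|[|j js] val|ws] //=; try by move=> _ _ [].
    by case cells_eq: cells => //; have := cells_nonempty.
  by move=> [<- <-] wwf _; split=> //; apply: view_return_read.
Qed.

(** * The invariant of the writer *)

Definition zeros (js : seq 'I_K) : seq ('I_K * bool) := [seq (j, false) | j <- js].

(** Here [u] is the old value. In [writer_below] it is smaller than [v] and still to be cleared, so
    the write has not taken effect; in [writer_above] every 1 other than that of [v] lies above [v]
    and is still to be cleared. *)
Inductive writer_inv M : option 'I_K -> lf_local K -> Prop :=
| writer_idle u wl : M =1 pred1 u -> writer_inv M None wl
| writer_start u v : M =1 pred1 u ->
    writer_inv M (Some v) (Writing ((v, true) :: zeros (cells_below v ++ cells_above v)))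
| writer_below u v js :
    M =1 pred2 u v -> u < v -> u \in js -> v \notin js ->
    writer_inv M (Some v) (Writing (zeros (js ++ cells_above v)))
| writer_above v js :
    M v -> (forall i, M i -> i = v \/ v < i /\ i \in js) -> v \notin js ->
    writer_inv M (Some v) (Writing (zeros js)).

(* The pending write has taken effect. *)
Definition installed M (v : 'I_K) (ws : seq ('I_K * bool)) : bool :=
  all (fun w => ~~ w.2) ws && (least M == v).

Lemma installed_least M v ws : installed M v ws -> least M = v.
Proof. by case/andP => _ /eqP. Qed.

Lemma all_zeros js : all (fun w => ~~ w.2) (zeros js).
Proof. by rewrite /zeros all_map; apply/allP. Qed.

Lemma installed_above M v (js : seq 'I_K) :
  M v -> (forall i, M i -> i = v \/ v < i /\ i \in js) -> installed M v (zeros js).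
Proof.
move=> Mv MP; rewrite /installed all_zeros; apply/eqP/leastE => // i /MP.
by case=> [->|[/ltnW]].
Qed.

Lemma not_installed_below M u v ws : M =1 pred2 u v -> u < v -> ~~ installed M v ws.
Proof.
move=> ME lt_uv; rewrite /installed (least2 ME lt_uv) andbC.
by case: eqP lt_uv => // ->; rewrite ltnn.
Qed.

Lemma writer_inv_writing M v ws : writer_inv M (Some v) (Writing ws) ->
  [\/ exists2 u, M =1 pred1 u & ws = (v, true) :: zeros (cells_below v ++ cells_above v),
      exists u js, [/\ M =1 pred2 u v, u < v, u \in js, v \notin js
        & ws = zeros (js ++ cells_above v)]
    | exists js, [/\ M v, forall i, M i -> i = v \/ v < i /\ i \in js, v \notin js
        & ws = zeros js]].
Proof.
move=> inv; inversion inv as [|u v' ME|u v' js|v' js]; subst.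
- by constructor 1; exists u.
- by constructor 2; exists u, js.
- by constructor 3; exists js.
Qed.

(** The phases of a write, indexed by whether it has taken effect before and after the step. Each
    records how the array may change, as the reader needs it. *)
Variant write_spec M v M' : bool -> bool -> Prop :=
| write_early : least M' = least M -> (forall u, M u -> u < v -> M' u) ->
    write_spec M v M' false false
| write_effective : (forall i, M' i -> i = least M \/ i = v) ->
    write_spec M v M' false true
| write_late : (forall i, M' i -> M i) -> write_spec M v M' true true.

Lemma writer_inv_write M v j b ws : writer_inv M (Some v) (Writing ((j, b) :: ws)) ->
  writer_inv (set_cell M j b) (Some v) (Writing ws) /\
  write_spec M v (set_cell M j b) (installed M v ((j, b) :: ws))
    (installed (set_cell M j b) v ws).
Proof.
move=> /writer_inv_writing [[u ME [? ? ?]]|[u [js [ME lt_uv u_js v_js +]]]|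
  [js [Mv MP v_js ws_eq]]]; subst.
- have M'E : set_cell M v true =1 pred2 u v.
    by move=> i; rewrite /set_cell ME /= orbC; case: eqP.
  have lM := least1 ME.
  (* Setting A[v] takes effect at once unless the old value [u] is smaller. *)
  have [lt_uv|le_vu] := ltnP u v.
    split.
      by apply: (@writer_below _ u); rewrite ?mem_cells_below ?ltnn.
    rewrite (negPf (not_installed_below _ M'E lt_uv)) {1}/installed /=.
    constructor; first by rewrite (least2 M'E lt_uv).
    by move=> i; rewrite ME M'E /= => ->.
  have M'P i : set_cell M v true i ->
      i = v \/ v < i /\ i \in cells_below v ++ cells_above v.
    rewrite M'E mem_cat mem_cells_above /= => /pred2P[]->; last by left.
    case: (ltngtP v u) le_vu => // [lt_vu _|eq_vu _]; last by left; apply: val_inj.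
    by right; rewrite orbT.
  have M'v : set_cell M v true v by rewrite M'E /= eqxx orbT.
  split.
    by apply: writer_above => //; rewrite mem_cat mem_cells_below mem_cells_above ltnn.
  rewrite (installed_above M'v M'P) {1}/installed /=.
  by constructor=> i; rewrite M'E lM => /pred2P.
- case: js u_js v_js => //= j0 js.
  rewrite !inE negb_or => u_js /andP[ne_vj v_js] [eq_j ? ?]; subst j0 b ws.
  rewrite (negPf (not_installed_below _ ME lt_uv)).
  (* Clearing the old value [u < v] is the step that takes effect; clearing any other cell here
     leaves the array unchanged. *)
  have [eq_uj|ne_uj] := eqVneq u j.
    subst u; have M'E : set_cell M j false =1 pred1 v.
      by move=> i; rewrite /set_cell ME /=; case: eqP => // ->; rewrite eq_sym (negPf ne_vj).
    have M'v : set_cell M j false v by rewrite M'E /=.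
    have M'P i : set_cell M j false i -> i = v \/ v < i /\ i \in js ++ cells_above v.
      by rewrite M'E => /eqP; left.
    rewrite (installed_above M'v M'P); split.
      by apply: writer_above; rewrite ?mem_cat ?(negPf v_js) ?mem_cells_above ?ltnn.
    by constructor=> i; rewrite M'E => /eqP; right.
  have M'E : set_cell M j false =1 pred2 u v.
    move=> i; rewrite /set_cell ME /=; case: eqP => // ->.
    by rewrite eq_sym (negPf ne_uj) eq_sym (negPf ne_vj).
  rewrite (negPf ne_uj) /= in u_js.
  split; first by apply: (@writer_below _ u).
  rewrite (negPf (not_installed_below _ M'E lt_uv)).
  constructor; first by rewrite (least2 ME lt_uv) (least2 M'E lt_uv).
  by move=> i; rewrite ME M'E.
- rewrite ws_eq (installed_above Mv MP).
  case: js MP v_js ws_eq => //= j0 js MP.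
  rewrite inE negb_or => /andP[ne_vj v_js] [eq_j ? ?]; subst j0 b ws.
  have M'v : set_cell M j false v by rewrite /set_cell (negPf ne_vj).
  have M'P i : set_cell M j false i -> i = v \/ v < i /\ i \in js.
    rewrite /set_cell; case: eqP => // /eqP ne_ij /MP [|[lt_vi]]; first by left.
    by rewrite inE (negPf ne_ij); right.
  rewrite (installed_above M'v M'P); split; first exact: writer_above.
  by constructor=> i; rewrite /set_cell; case: eqP.
Qed.

Lemma writer_inv_return M v wl : writer_inv M (Some v) (Writing [::]) ->
  [/\ writer_inv M None wl, M =1 pred1 v & installed M v [::]].
Proof.
move=> /writer_inv_writing [[]|[u [js [_ _ u_js _]]]|[js [Mv MP _ ws_eq]]] //.
  by case: js u_js.
have ME : M =1 pred1 v.
  case: js MP ws_eq => // MP _ i /=.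
  by apply/idP/eqP => [/MP [|[]]|->].
split=> //; first exact: writer_idle ME.
by rewrite /installed /= (least1 ME).
Qed.

Definition view_installed (x : view) : bool :=
  if (writing x, writer_loc x) is (Some v, Writing ws) then installed (array x) v ws else false.

Definition view_inv (x : view) : Prop := writer_inv (array x) (writing x) (writer_loc x).

Lemma view_inv_step x e x' : view_step x e x' -> view_inv x -> view_inv x'.
Proof.
rewrite /view_inv; case=> //=.
- by move=> M wl _ _ v inv; inversion inv as [u wl' ME| | |]; apply: (@writer_start _ u).
- by move=> M v j b ws _ _ /writer_inv_write[].
- by move=> M v _ _ /(writer_inv_return idle) [].
Qed.

Lemma installed_step x e x' : view_step x e x' -> view_inv x ->
  view_installed x -> view_installed x' \/ e = Respond Writer Ack.
Proof.
rewrite /view_inv /view_installed; case=> //=; try by left.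
- by move=> M v j b ws _ _ /writer_inv_write[_ []] //; left.
- by right.
Qed.

(** Before a write takes effect [write_early] fixes the least 1; afterwards the least 1 is the
    written value on both sides of a step. *)
Lemma least_step x e x' : view_step x e x' -> view_inv x ->
  least (array x') = least (array x) \/
  [/\ ~~ view_installed x, view_installed x' & isSome (writing x)].
Proof.
rewrite /view_inv /view_installed; case=> //=; try by left.
move=> M v j b ws _ _ /writer_inv_write[_].
move inst: (installed _ _ ((j, b) :: ws)) => b1; move inst': (installed _ _ ws) => b2 sp.
case: sp inst inst' => [|_ _ _|_ /installed_least-> /installed_least->]; by [left|right|left].
Qed.

Lemma view_least (x : view) v : view_installed x -> writing x = Some v -> least (array x) = v.
Proof.
by case: x => M [w|] [|?|? ?|ws] rp rl; rewrite /view_installed //= => /installed_least -> [].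
Qed.

(** * The invariant of the reader *)

(* [S] is the set of abstract values since the start of the pending read. This
   holds of a cell [c] once it was read as [0]: if the pending write has moved the
   least [1] to [c], it did so after that, hence the old value is in [S]. *)
Definition scanned (S : 'I_K -> Prop) (x : view) (c : 'I_K) : Prop :=
  view_installed x -> least (array x) = c -> forall j, array x j -> S j.

(* If [val] is not an abstract value yet, it is about to become one, when the
   pending write clears the old value [u], which the reader has not passed. *)
Definition candidate (S : 'I_K -> Prop) (x : view) (js : seq 'I_K) (val : 'I_K) : Prop :=
  S val \/ exists u, [/\ u \in js, u < val, array x u & writing x = Some val].

(** In the downward scan the cells of [js] were read as 0 on the way up; they stay [scanned] in case
    a 1 is found beyond them. Downward closure of [js] ensures that no smaller cell is skipped. *)
Definition reader_inv (S : 'I_K -> Prop) (x : view) : Prop :=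
  match reader_loc x with
  | ScanUp js => sorted (fun i j : 'I_K => i < j) js /\
      forall c, c \notin js -> scanned S x c
  | ScanDown js val =>
      [/\ sorted (fun i j : 'I_K => j < i) js,
          forall i j, j \in js -> i < j -> i \in js,
          forall c, c \in js -> scanned S x c & candidate S x js val]
  | _ => False
  end.

(** By the phase of the writer. If the array is a singleton, [c] is the least 1. In [writer_below],
    [c] is either the least 1 or the value being written, with the old value still ahead in [js]. In
    [writer_above], a [c] other than [v] exceeds [v], and [scanned] at [v] puts [c] in [S]. *)
Lemma candidate_found (S : 'I_K -> Prop) (x : view) js c : view_inv x -> S (least (array x)) ->
  array x c -> (forall i, i < c -> i \in js /\ scanned S x i) -> candidate S x js c.
Proof.
case: x => M wp wl rp rl; rewrite /view_inv /scanned /view_installed /candidate /=.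
case=> {wp wl} [u wl ME|u v ME|u v js' ME lt_uv u_js v_js|v js' Mv MP v_js] lM Mc below_c.
- by left; move: Mc; rewrite ME => /eqP ->; rewrite -(least1 ME).
- by left; move: Mc; rewrite ME => /eqP ->; rewrite -(least1 ME).
- have: c = u \/ c = v by move: Mc; rewrite ME => /pred2P.
  case=> ?; subst; first by left; rewrite -(least2 ME lt_uv).
  by right; exists u; rewrite ME /= eqxx; split=> //; case: (below_c _ lt_uv).
- have lMv := installed_least (installed_above Mv MP).
  have [->|[lt_vc _]] := MP _ Mc; first by left; rewrite -lMv.
  left; have [_ scan] := below_c _ lt_vc.
  by apply: (scan (installed_above Mv MP) lMv).
Qed.

Lemma scanned_zero (S : 'I_K -> Prop) (x : view) c : view_inv x -> ~~ array x c -> scanned S x c.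
Proof.
case: x => M wp wl rp rl; rewrite /view_inv /scanned /view_installed /=.
case=> {wp wl} [u wl ME|u v ME|u v js' ME lt_uv u_js v_js|v js' Mv MP v_js] //=.
  by rewrite (negPf (not_installed_below _ ME lt_uv)).
by move=> Mc _; rewrite (installed_least (installed_above Mv MP)) => eq_v; move: Mc; rewrite -eq_v Mv.
Qed.

Section ReaderStep.
Variables (S S' : 'I_K -> Prop).
Hypothesis SS' : forall j, S j -> S' j.

(** When the write takes effect, the remaining 1s are at the old abstract value, in [S], or at the
    new one, in [S']. Later writes only remove 1s. *)
Lemma scanned_step x e x' c : view_step x e x' -> view_inv x ->
  S (least (array x)) -> S' (least (array x')) -> scanned S x c -> scanned S' x' c.
Proof.
rewrite /scanned /view_inv /view_installed; case=> //=; try by move=> *; apply: SS'; auto.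
move=> M v j b ws rp rl /writer_inv_write[_].
move inst: (installed _ _ ((j, b) :: ws)) => b1; move inst': (installed _ _ ws) => b2 sp.
case: sp inst inst' => [//|M'P|M'M].
  move=> _ /installed_least lM' Sl S'l _ _ _ i /M'P [->|->]; first exact: SS'.
  by rewrite -lM'.
move=> /installed_least lM /installed_least lM' _ _ scan _ eqc i /M'M Mi.
by apply: SS'; apply: scan => //; rewrite lM -lM'.
Qed.

(** An early step keeps the 1 at [u]. The effective step makes [val] the abstract value. Later
    steps, and the return of the write, are impossible: [val] would be the least 1 although [u] is
    smaller. *)
Lemma candidate_step x e x' js val : view_step x e x' -> view_inv x ->
  S' (least (array x')) -> candidate S x js val -> candidate S' x' js val.
Proof.
move=> st inv S'l [/SS'|[u [u_js lt_u xu wx]]]; first by left.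
move: st inv S'l xu wx; rewrite /view_inv /candidate.
case=> //=; try by move=> *; right; exists u.
- move=> M v j b ws rp rl /writer_inv_write[_ sp] S'l Mu [eq_v]; subst v.
  move: sp; move inst: (installed _ _ ((j, b) :: ws)) => b1.
  move inst': (installed _ _ ws) => b2 sp.
  case: sp inst inst' => [_ keep _ _|_ _ /installed_least lM'|_ /installed_least lM _].
  + by right; exists u; split=> //; apply: keep.
  + by left; rewrite -lM'.
  + by have [_] := leastP Mu; rewrite lM leqNgt lt_u.
- move=> M v rp rl /(writer_inv_return idle)[_ ME _] _; rewrite ME => /eqP eq_u [eq_v].
  by move: lt_u; rewrite eq_u eq_v ltnn.
Qed.

Lemma reader_inv_step x e x' : view_step x e x' -> view_inv x ->
  S (least (array x)) -> S' (least (array x')) ->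
  reading x -> reading x' -> reader_inv S x -> reader_inv S' x'.
Proof.
move=> st inv Sl S'l rx rx'.
have scan_step c := @scanned_step _ _ _ c st inv Sl S'l.
have cand_step js val := @candidate_step _ _ _ js val st inv S'l.
(* This settles the events of the writer. *)
have other : reader_loc x' = reader_loc x -> reader_inv S x -> reader_inv S' x'.
  move=> eq_loc; rewrite /reader_inv eq_loc.
  case: (reader_loc x) => // [js [sjs scan]|js val [sjs closed scan cand]]; split=> //.
  - by move=> c /scan /scan_step.
  - by move=> c /scan /scan_step.
  - exact: cand_step.
case: st inv Sl S'l rx rx' scan_step cand_step other => //=; try by move=> *; auto.
- move=> M wp wl js0 j js js0_eq inv Sl _ _ _ scan_step cand_step _ [sjs scan].
  (* If [js0] is empty, every cell is already [scanned] and the new scan begins with all of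
     [cells]. *)
  have {}scan c : c \notin j :: js -> scanned S (View M wp wl true (ScanUp js0)) c.
    by move=> c_js; apply: scan; move: c_js; rewrite -js0_eq; case: (js0).
  have /sorted_ord_lt[{}sjs lt_j] : sorted (fun i j : 'I_K => i < j) (j :: js).
    by rewrite -js0_eq; case: (js0) sjs => // _; apply: sorted_all_cells.
  have below_j (c : 'I_K) : c < j -> scanned S (View M wp wl true (ScanUp js0)) c.
    move=> lt_cj; apply: scan; apply/negP; rewrite inE => /predU1P [eq_cj|/lt_j].
      by rewrite eq_cj ltnn in lt_cj.
    by rewrite ltnNge ltnW.
  rewrite /reader_inv /=; case: ifPn => [Mj|nMj].
    split=> [|i i'|c|]; first exact: sorted_cells_below.
    - by rewrite !mem_cells_below => lt_i' lt_i; apply: ltn_trans lt_i'.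
    - by rewrite mem_cells_below => /below_j /scan_step.
    - apply: cand_step; apply: candidate_found => //= i lt_ij.
      by rewrite mem_cells_below; split=> //; apply: below_j.
  split=> // c c_js; apply: scan_step.
  have [->|ne_cj] := eqVneq c j; first exact: scanned_zero.
  by apply: scan; rewrite inE negb_or ne_cj.
- move=> M wp wl j js val inv Sl _ _ _ scan_step cand_step _ [sjs closed scan cand].
  have [{}sjs lt_j] := sorted_ord_gt sjs.
  have js_scan c : c \in js -> scanned S (View M wp wl true (ScanDown (j :: js) val)) c.
    by move=> c_js; apply: scan; rewrite inE c_js orbT.
  have below_mem (i i' : 'I_K) : i' \in j :: js -> i < i' -> i \in js.
    move=> i'_js lt_i; have := closed _ _ i'_js lt_i; rewrite inE => /predU1P[eq_ij|//].
    move: i'_js; rewrite inE => /predU1P[eq_i'|/lt_j]; first by rewrite eq_ij eq_i' ltnn in lt_i.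
    by rewrite -eq_ij ltnNge ltnW.
  split=> //.
  - by move=> i i' i'_js; apply: below_mem; rewrite inE i'_js orbT.
  - by move=> c /js_scan /scan_step.
  apply: cand_step; case: ifPn => Mj.
    apply: candidate_found => //= i /(below_mem i j) i_js.
    have {}i_js := i_js (mem_head _ _); split=> //; exact: js_scan.
  case: cand => [|[u [u_js lt_u Mu wu]]]; [by left | right; exists u; split=> //].
  by move: u_js; rewrite inE => /predU1P[eq_uj|//]; case/negP: Mj; rewrite -eq_uj.
Qed.

End ReaderStep.

(** * Termination measure *)

(* The most significant part bounds the number of remaining events of the writer
   before its next response, the rest those of the reader if the array no longer
   changes: in a failing scan the reader will have to scan once more. *)
Definition writer_measure (x : view) : nat :=
  if writing x is Some _ then
    if writer_loc x is Writing ws then size ws else 0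
  else K.*2.+2.

(** The summand [K.+1] leaves room for a downward scan of at most [K] cells, and [K.*2.+2] for a
    further upward scan before it. The value without a pending read exceeds that of a fresh scan. *)
Definition reader_measure (x : view) : nat :=
  if reading x then
    match reader_loc x with
    | ScanUp js => size js + (if has (array x) js then K.+1 else K.*2.+2)
    | ScanDown js _ => size js
    | _ => 0
    end
  else K.*2.+3 + K.

(** A lexicographic order encoded in a base that exceeds every value of [reader_measure]. *)
Definition view_measure (x : view) : nat :=
  writer_measure x * (K.*2.+4 + K) + reader_measure x.

Lemma reader_measure_lt S x : (reading x -> reader_inv S x) -> reader_measure x < K.*2.+4 + K.
Proof.
rewrite /reader_measure /reader_inv; case: (reading x) => // /(_ isT).
have le_K : K.+1 <= K.*2.+2 by rewrite -addnn !ltnS leqW // leq_addr.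
case: (reader_loc x) => // [js [/sorted_lt_size le_js _]|js val [/sorted_gt_size le_js _ _ _]].
  rewrite addnC addSn ltnS leq_add //.
  by case: ifP => _; [apply: leq_trans le_K _|].
by rewrite (leq_ltn_trans le_js) // -[X in X < _]add0n ltn_add2r.
Qed.

Lemma view_measure_step x e x' : view_step x e x' -> view_inv x ->
  reader_measure x' < K.*2.+4 + K -> ~~ is_respond e -> view_measure x' < view_measure x.
Proof.
have writer_decr y y' : writer_measure y' < writer_measure y ->
    reader_measure y' < K.*2.+4 + K -> view_measure y' < view_measure y.
  move=> lt_w lt_r; rewrite /view_measure.
  apply: leq_trans (leq_addr _ _); apply: leq_trans (leq_mul lt_w (leqnn _)).
  by rewrite mulSn addnC ltn_add2r.
have reader_decr y y' : writer_measure y' = writer_measure y ->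
    reader_measure y' < reader_measure y -> view_measure y' < view_measure y.
  by rewrite /view_measure => -> lt_r; rewrite ltn_add2l.
case=> //.
- move=> M wl rp rl v inv lt_r _; apply: writer_decr lt_r.
  rewrite /writer_measure /= size_map size_cat size_rev -addnn !ltnS.
  by rewrite leq_add // size_filter (leq_trans (count_size _ _)) ?size_all_cells.
- by move=> M v j b ws rp rl _ lt_r _; apply: writer_decr lt_r.
- move=> M wp wl rl _ _ _; apply: reader_decr => //.
  rewrite /reader_measure /= size_all_cells [_ + K]addnC ltn_add2l.
  by case: ifP => // _; rewrite -addnn !ltnS leqW // leq_addr.
- move=> M wp wl js0 j js js0_eq inv _ _; apply: reader_decr => //.
  have below_K : size (cells_below j) <= K by apply/sorted_gt_size/sorted_cells_below.
  rewrite /reader_measure /=; case: js0 js0_eq inv => [cells_eq inv|j0 js0 [-> ->] _] /=.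
    (* On a restart some cell holds 1, since the array is never all zero; if it is not the first
       cell, it is among the remaining ones. *)
    have /hasP[i _ Mi] : has M cells.
      have [u Mu] : exists u, M u.
        move: inv; rewrite /view_inv; case=> /= [u _ ME|u v ME|u v js' ME _ _ _|v js' Mv _ _].
        - by exists u; rewrite ME /=.
        - by exists u; rewrite ME /=.
        - by exists u; rewrite ME /= eqxx.
        - by exists v.
      by apply/hasP; exists u => //; apply: mem_all_cells.
    have lt_js : size js < K.
      by have := size_all_cells; rewrite cells_eq /= => size_js; rewrite -[X in _ < X]size_js.
    case: ifPn => [_|nMj]; first by rewrite ltnS (leq_trans below_K) // -addnn -addnS leq_addr.
    have -> : has M js.
      apply/hasP; exists i => //; have := mem_all_cells i; rewrite cells_eq inE.
      by case/predU1P => // eq_ij; move: nMj; rewrite -eq_ij Mi.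
    by rewrite add0n -addnn addnS !ltnS leq_add2r ltnW.
  case: (M j) => /=; last by rewrite addSn.
  by rewrite (leq_ltn_trans below_K) // addnS ltnS leq_addl.
- move=> M wp wl j js val _ _ _; exact: reader_decr.
Qed.

End Views.

(** * Linearization points of LF *)

Section LFTrace.
Variables (ev : nat -> option event) (cs : nat -> config (LF v0)).
Hypothesis tr : trace ev cs.

Let vs n : view := config_view (cs n).
Definition value_at n : 'I_K := least (memory (cs n)).
Local Notation Entry := (@Entry swsr_proc (register v0)).
Local Notation open_at := (@open_at swsr_proc (register v0) ev).

Lemma trace_wf n : [/\ writer_wf (cs n), reader_wf (cs n) & view_inv (vs n)].
Proof.
elim: n => [|n [wwf rwf inv]].
  by rewrite /vs tr.1; split=> //; apply: (@writer_idle _ v0).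
have := tr.2 n; rewrite /vs; case: (ev n) => [e|->//] st.
have [wwf' rwf' vst] := config_step st wwf rwf; split=> //.
exact: view_inv_step vst inv.
Qed.

Lemma trace_view_inv n : view_inv (vs n).
Proof. by have [] := trace_wf n. Qed.

Lemma trace_view_step n e : ev n = Some e -> view_step (vs n) e (vs n.+1).
Proof.
have [wwf rwf _] := trace_wf n.
by have := tr.2 n => /[swap] -> /config_step[].
Qed.

Lemma writing_pending n v : writing (vs n) = Some v <-> pending (cs n) Writer = Some (Write v).
Proof. by rewrite /=; case: (pending _ _) => [[|w]|] //; split=> -[->]. Qed.

(** The range starts at configuration [i + 1], the first one after the invocation at [i]. *)
Definition seen i n (v : 'I_K) : Prop := exists2 t, i < t <= n & value_at t = v.

Lemma trace_reader_inv i n : open_at Reader Read i n -> reader_inv (seen i n) (vs n).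
Proof.
elim: n => [|n IHn]; first by case.
move=> op; case: (open_atS op) => [[<- /trace_view_step st]|[op' noresp]].
  move: st; rewrite /reader_inv; move eE: (Invoke _ _) => e st; case: st eE => // M wp wl rl _.
  by split=> [|c]; [apply: sorted_all_cells | rewrite mem_all_cells].
have sub (c : 'I_K) : seen i n c -> seen i n.+1 c.
  by move=> [t /andP[it tn] <-]; exists t => //; rewrite it leqW.
have seen_now k : i < k -> seen i k (least (array (vs k))) by move=> ik; exists k; rewrite ?ik /=.
have rx k : open_at Reader Read i k -> reading (vs k).
  by move=> /(open_at_pending tr) /= ->.
case evn: (ev n) => [e|].
  apply: (reader_inv_step sub (trace_view_step evn)) (IHn op'); try exact: rx.
  - exact: trace_view_inv.
  - by case: op' => _ lt_in _; apply: seen_now.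
  - by case: op => _ lt_in _; apply: seen_now.
have vsE : vs n.+1 = vs n by have := tr.2 n; rewrite evn /vs => ->.
rewrite vsE; have := IHn op'; rewrite /reader_inv /candidate /scanned.
case: (reader_loc _) => // [js [sjs scan]|js val [sjs closed scan cand]]; split=> //.
- by move=> c c_js inst eqc j xj; apply: sub; apply: scan eqc _ xj.
- by move=> c c_js inst eqc j xj; apply: sub; apply: scan eqc _ xj.
- by case: cand => [/sub|]; [left|right].
Qed.

(** A write acts at the event that installs it, even if it never returns; a read that returns acts
    just after some event, at the first moment when its result is the abstract value. Minimality
    makes that point unique. *)
Inductive takes_effect : nat -> entry swsr_proc (register v0) -> Prop :=
| write_takes_effect n i v :
    open_at Writer (Write v) i n -> ~~ view_installed (vs n) -> view_installed (vs n.+1) ->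
    takes_effect n.*2 (Entry i Writer (Write v) Ack)
| read_takes_effect n i j v :
    ev i = Some (Invoke Reader Read) -> returns_at ev i j (Val v) ->
    i <= n < j -> value_at n.+1 = v -> (forall n', i <= n' < n -> value_at n'.+1 <> v) ->
    takes_effect n.*2.+1 (Entry i Reader Read (Val v)).

Lemma takes_effect_fun k x x' : takes_effect k x -> takes_effect k x' -> x = x'.
Proof.
case=> [n i v op _ _|n i j v evi ret /andP[le_in lt_nj] vn _].
  move kE: n.*2 => k' H; case: H kE => [n' i' v' op' _ _|n' i' j' v' _ _ _ _ _] /=.
    move=> /double_inj eq_n; subst n'; have eq_i := open_at_inj tr op op'; subst i'.
    by case: op op' => evi _ _ []; rewrite evi => -[->].
  by move=> /(congr1 odd); rewrite /= !odd_double.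
move kE: n.*2.+1 => k' H.
case: H kE => [n' i' v' _ _ _|n' i' j' v' evi' ret' /andP[le_in' lt_nj'] vn' _].
  by move=> /(congr1 odd); rewrite /= !odd_double.
move=> -[] /double_inj eq_n; subst n'.
have [p [o op]] := @returns_open_at _ _ ev _ _ _ n.+1 ret (introT andP (conj le_in lt_nj)).
have [p' [o' op']] := @returns_open_at _ _ ev _ _ _ n.+1 ret' (introT andP (conj le_in' lt_nj')).
have eq_p : p = Reader /\ p' = Reader.
  by case: op op' => + _ _ [+ _ _]; rewrite evi evi' => -[-> _] [->].
move: op op'; rewrite eq_p.1 eq_p.2 => op /(open_at_inj tr op) eq_i.
by rewrite -vn -vn' eq_i.
Qed.

Lemma installed_persists i n n' v : open_at Writer (Write v) i n' -> i < n <= n' ->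
  view_installed (vs n) -> view_installed (vs n').
Proof.
move=> [_ _ noresp] /andP[lt_in] /subnK; move: (n' - n) => d n'E inst; subst n'.
elim: d noresp => // d IHd noresp.
have {}IHd : view_installed (vs (d + n)).
  by apply: IHd => k r /andP[ik kn]; apply: noresp; rewrite ik addSn leqW.
rewrite addSn; case evn: (ev (d + n)) => [e|]; last first.
  by have := tr.2 (d + n); rewrite evn /vs => ->.
have [//|eq_e] := installed_step (trace_view_step evn) (trace_view_inv _) IHd.
case: (noresp (d + n) Ack); last by rewrite evn eq_e.
by rewrite addSn leqnn andbT (leq_trans lt_in) ?leq_addl.
Qed.

Lemma not_installed_invoke i v : ev i = Some (Invoke Writer (Write v)) ->
  ~~ view_installed (vs i.+1).
Proof.
move=> /trace_view_step; rewrite /view_installed.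
by move eE: (Invoke _ _) => e st; case: st eE.
Qed.

Lemma takes_effect_unique k k' x x' : takes_effect k x -> takes_effect k' x' ->
  ident x = ident x' -> k = k'.
Proof.
case=> [n i v op ninst inst|n i j v evi ret /andP[le_in lt_nj] vn fst];
  case=> [n' i' v' op' ninst' inst'|n' i' j' v' evi' ret' /andP[le_in' lt_nj'] vn' fst'] /= eq_i;
  subst i'.
- have le n1 n2 v1 v2 : open_at Writer (Write v1) i n1 -> open_at Writer (Write v2) i n2 ->
      view_installed (vs n1.+1) -> ~~ view_installed (vs n2) -> n2 <= n1.
    move=> [_ lt_i _] op2 inst1; apply: contraR; rewrite -ltnNge => lt_n.
    by apply: (installed_persists op2) inst1; rewrite lt_n ltnW.
  apply: (congr1 double); apply/eqP; rewrite eqn_leq (le n' n _ _ op' op inst' ninst).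
  by rewrite (le n n' _ _ op op' inst ninst').
- by case: op; rewrite evi'.
- by case: op'; rewrite evi.
- have [_ [eq_v]] := returns_at_inj ret ret'; subst v'.
  apply: (congr1 (fun n => n.*2.+1)); case: (ltngtP n n') => // lt_n.
    by case: (fst' n); rewrite ?le_in ?vn.
  by case: (fst n'); rewrite ?le_in'.
Qed.

Lemma first_change (b : nat -> bool) n n' : n <= n' -> ~~ b n -> b n' ->
  exists2 k, n <= k < n' & ~~ b k /\ b k.+1.
Proof.
move=> /subnK <-; elim: (n' - n) => [|d IHd] nb; first by rewrite (negPf nb).
rewrite addSn => bd; case bd': (b (d + n)).
  by have [k /andP[nk kd] Hk] := IHd nb bd'; exists k; rewrite // nk ltnW.
by exists (d + n); rewrite ?bd' ?bd ?leq_addl /=.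
Qed.

Lemma returns_takes_effect i j r : returns_at ev i j r ->
  exists k x, [/\ takes_effect k x, ident x = i, result x = r & k < j.*2].
Proof.
move=> ret; have [p [o [evi lt_ij evj noresp]]] := ret.
have op : open_at p o i j by split.
have st := trace_view_step evj; have may_po := open_at_may tr op.
case: p o => [] [|v] // in evi evj noresp op st may_po *.
  have [inst -> {st}] : view_installed (vs j) /\ r = Ack.
    have := trace_view_inv j; rewrite /view_inv /view_installed; move: st.
    move eE: (Respond _ _) => e st; case: st eE => // M w rp rl.
    by move=> [->] /(writer_inv_return idle)[].
  have [n /andP[lt_in lt_nj] [ninst inst']] :=
    @first_change (fun n => view_installed (vs n)) _ _ lt_ij (not_installed_invoke evi) inst.
  exists n.*2, (Entry i Writer (Write v) Ack); split=> //; last by rewrite ltn_double.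
  apply: write_takes_effect => //; split=> // k r' /andP[ik kn].
  by apply: noresp; rewrite ik (ltn_trans kn).
(* At the return no cell is left to scan, so [candidate] reduces to membership of the result in the
   values seen. *)
have [v rE [t /andP[lt_it le_tj] vt] {st}] : exists2 v, r = Val v & seen i j v.
  have := trace_reader_inv op; rewrite /reader_inv; move: st.
  move eE: (Respond _ _) => e st; case: st eE => // M wp wl val [->] [_ _ _ cand].
  by exists val => //; case: cand => // -[u []].
subst r; have ex_n : exists n, (i <= n < j) && (value_at n.+1 == v).
  (* Configuration [t] follows event [t - 1]. *)
  by exists t.-1; case: t lt_it le_tj vt => // t; rewrite ltnS /= => -> -> ->; rewrite eqxx.
case: (ex_minnP ex_n) => n /andP[/andP[le_in lt_nj] /eqP vn] n_min.
exists n.*2.+1, (Entry i Reader Read (Val v)); split=> //; last first.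
  by rewrite -doubleS leq_double.
apply: (@read_takes_effect n i j) => //.
- by rewrite le_in.
- move=> n' /andP[le_in' lt_n'] /eqP vn'.
  have := n_min n'; rewrite le_in' vn' (ltn_trans lt_n') // leqNgt lt_n'.
  by move=> /(_ isT).
Qed.

Lemma takes_effect_invoked k x : takes_effect k x ->
  ev (ident x) = Some (Invoke (proc x) (oper x)) /\ (ident x).*2 < k.
Proof.
case=> [n i v [evi lt_in _] _ _|n i j v evi _ /andP[le_in _] _ _] /=.
  by rewrite ltn_double.
by rewrite ltnS leq_double.
Qed.

Lemma takes_effect_event k x : takes_effect k x -> exists2 n, k./2 <= n & ev n.
Proof.
case=> [n i v op ninst inst|n i j v _ [p [o [_ _ evj _]]] /andP[_ lt_nj] _ _].
  rewrite doubleK; exists n => //; case evn: (ev n) => //.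
  by have := tr.2 n; rewrite evn => eq_cs; move: inst; rewrite /vs eq_cs (negPf ninst).
by exists j; rewrite ?evj //= uphalf_double ltnW.
Qed.

Lemma takes_effect_legal k x : takes_effect k x ->
  @delta (register v0) (value_at (uphalf k)) (oper x) = (value_at (uphalf k.+1), result x).
Proof.
case=> [n i v op ninst inst|n i j v _ _ _ vn _] /=; rewrite ?doubleK ?uphalf_double; last first.
  by rewrite vn.
congr pair; apply/esym/(view_least inst); have wn := open_at_pending tr op.
have /writing_pending <- := wn.
case evn: (ev n) => [e|]; last by have := tr.2 n; rewrite evn /vs => ->.
move: (trace_view_step evn) ninst inst; rewrite /view_installed.
by case=> //= M wl rp rl v' _; case: wl.
Qed.

(** At odd times no event occurs; at even times [least_step] shows that a change of value would be
    the point of a pending write. *)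
Lemma takes_effect_none k : (forall x, ~ takes_effect k x) ->
  value_at (uphalf k.+1) = value_at (uphalf k).
Proof.
have := odd_double_half k; move: k./2 => n; case: (odd k) => <-; rewrite ?add1n ?add0n /=.
  by rewrite doubleK uphalf_double.
rewrite uphalf_double doubleK => none.
case evn: (ev n) => [e|]; last by have := tr.2 n; rewrite evn /value_at => ->.
have [//|[ninst inst]] := least_step (trace_view_step evn) (trace_view_inv n).
case wn: (writing (vs n)) => [v|//] _.
have /writing_pending/(pending_open_at tr)[i op] := wn.
by case: (none _ (write_takes_effect op ninst inst)).
Qed.

(** Time [2n] is event [n] and time [2n + 1] is configuration [n + 1], so configuration [uphalf k]
    gives the value just before the point at [k]. The last clause bounds the points of a finite
    execution. *)
Lemma lf_linearization_points : exists E,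
  linearization_points ev E (fun k => value_at (uphalf k)) /\
  forall k x, E k = Some x -> exists2 n, k./2 <= n & ev n.
Proof.
have [E EP] := functional_choice takes_effect_fun; exists E; split; last first.
  by move=> k x /EP /takes_effect_event.
split.
- by move=> k x /EP /takes_effect_invoked [].
- by move=> k x /EP /takes_effect_invoked [].
- by move=> k k' x x' /EP Hx /EP; apply: takes_effect_unique.
- move=> i j r /returns_takes_effect [k [x [Hx xi xr lt_k]]].
  by exists k, x; split=> //; apply/EP.
- by rewrite /value_at tr.1; apply: least1.
- by move=> k x /EP /takes_effect_legal.
- move=> k Ek; apply: takes_effect_none => x /EP; by rewrite Ek.
Qed.

Lemma trace_measure n e : ev n = Some e -> ~~ is_respond e ->
  view_measure (vs n.+1) < view_measure (vs n).
Proof.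
move=> evn; apply: view_measure_step (trace_view_step evn) (trace_view_inv n) _.
case rn: (reading (vs n.+1)); last first.
  by apply: (@reader_measure_lt (fun=> True)); rewrite rn.
have [o pn] : exists o, pending (cs n.+1) Reader = Some o.
  by move: rn; rewrite /=; case: (pending _ _) => // o _; exists o.
have [i op] := pending_open_at tr pn.
have o_read : o = Read by have := open_at_may tr op; case: (o).
rewrite o_read in op.
by apply: (@reader_measure_lt (seen i n.+1)) => _; apply: trace_reader_inv.
Qed.

End LFTrace.

(** * Lock-freedom, linearizability and history independence *)

Lemma LF_lock_free : lock_free (LF v0).
Proof.
move=> cs es /trace_inf tr n _ _; apply: contrapT => no_resp.
(* Without a response from [n] on, every event lowers the measure. *)
have decr d : view_measure (config_view (cs (n + d))) + d <= view_measure (config_view (cs n)).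
  elim: d => [|d IHd]; first by rewrite !addn0.
  have lt_measure : view_measure (config_view (cs (n + d).+1)) <
      view_measure (config_view (cs (n + d))).
    apply: trace_measure tr _ _ (erefl _) _.
    by apply/negP => resp; apply: no_resp; exists (n + d); rewrite ?leq_addr.
  by rewrite (addnS n) addnS -addSn (leq_trans _ IHd) // leq_add2r.
have := decr (view_measure (config_view (cs n))).+1.
by rewrite addnS ltnNge leq_addl.
Qed.

(** The equation is for history independence: it makes the final abstract state a function of the
    memory. *)
Lemma LF_fin_linearization (al : fin_seq (LF v0)) : fin_execution al ->
  exists L, fin_linearization al L /\ final_state L = least (memory (last_config al)).
Proof.
move=> /trace_fin tr; have [E [pts bounded]] := lf_linearization_points tr.
have E_lt k : E k -> k < (size al).*2.
  case Ek: (E k) => [x|] // _; have [n le_n] := bounded _ _ Ek.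
  by rewrite onthTE size_map -ltn_half_double => /(leq_ltn_trans le_n).
exists (compressed E (size al).*2); split.
  exact: linearization_of_points pts (compression_finite E_lt).
by rewrite (final_state_of_points _ pts) uphalf_double /value_at take_size.
Qed.

Lemma LF_linearizable : linearizable (LF v0).
Proof.
split=> [al /LF_fin_linearization [L [linL _]]|cs es /trace_inf tr]; first by exists L.
have [E [pts _]] := lf_linearization_points tr.
have [L LP] := compression_exists E.
by exists L; apply: linearization_of_points pts LP.
Qed.

Lemma quiescent_array (al : fin_seq (LF v0)) : 1 < K -> fin_execution al ->
  state_quiescent (last_config al) ->
  forall i, memory (last_config al) i = (i == least (memory (last_config al))).
Proof.
move=> lt1K /trace_fin tr quiescent.
have := trace_view_inv tr (size al); rewrite take_size /view_inv /=.
move: quiescent; rewrite /state_quiescent; move: (last_config al) => c quiescent.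
have -> : (if pending c Writer is Some (Write v) then Some v else None) = None.
  case pw: (pending c Writer) => [[|v]|] //; case: (quiescent _ _ pw).
  (* As there are two states, [Write v] changes one of them, so no write is pending in a quiescent
     configuration. *)
  have lt0K := ltnW lt1K; have [v_0|v_n0] := eqVneq v (Ordinal lt0K).
    by exists (Ordinal lt1K); rewrite /= v_0 => /(congr1 val).
  by exists (Ordinal lt0K) => /= v_0; rewrite v_0 eqxx in v_n0.
move eq_wp: None => wp inv; case: inv eq_wp => // u wl ME _ i.
by rewrite (least1 ME) ME.
Qed.

Lemma LF_state_quiescent_HI : 1 < K -> state_quiescent_HI (LF v0).
Proof.
move=> lt1K.
have /choice[h hP] : forall al : fin_seq (LF v0), exists L, fin_execution al ->
    fin_linearization al L /\ final_state L = least (memory (last_config al)).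
  move=> al; case: (pselect (fin_execution al)) => [/LF_fin_linearization[L HL]|not_exec].
    by exists L.
  by exists [::].
exists h; split=> [al /hP[]//|al al' [exec quiescent] [exec' quiescent']].
have [_ ->] := hP _ exec; have [_ ->] := hP _ exec' => eq_least i.
by rewrite (quiescent_array lt1K exec quiescent) eq_least -quiescent_array.
Qed.

End LFCorrectness.

Theorem theorem9 (K : nat) (hK : 3 <= K) (v0 : 'I_K) :
  linearizable (LF v0) /\ lock_free (LF v0) /\ state_quiescent_HI (LF v0).
Proof.
split; first exact: LF_linearizable.
split; first exact: LF_lock_free.
exact/LF_state_quiescent_HI/ltnW.
Qed.
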